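(* For every positive integer $k$, all real numbers $c,\delta>0$, and every real $\varepsilon$ with $0<\varepsilon\leq 1/3$, there exists a positive number $Z_0=Z_0(k,c,\delta,\varepsilon)$ with the following property: if $S$ is a $\delta$-separated point set in an interval $I\subset\mathbb{R}$ of length $|I|=L$, with at least $cL$ points, where $L\geq Z_0$, then $S$ contains a $k$-point subset that forms an $\varepsilon$-approximate arithmetic progression of $k$ terms. Moreover, one can set $$ Z_0(k,c,\delta,\varepsilon)=2\delta\cdot (ks)^j, \quad\text{where}\quad s=\left\lceil \frac{1}{\varepsilon} \right\rceil, \qquad r=\frac{k}{k-1}, \qquad j=\left\lceil \frac{\log \frac{2}{c\delta}}{\log r} \right\rceil. $$
   Context: Let $\delta>0$. A point set $S\subset\mathbb{R}^d$ is $\delta$-separated if the minimum pairwise Euclidean distance among points of $S$ is at least $\delta$. A set $Q'$ is homothetic to a finite pattern $P\subset\mathbb{R}^d$ if $Q'=\lambda P+v$ for some $\lambda>0$ and $v\in\mathbb{R}^d$ (scaling and translation, no rotation). For $0<\varepsilon\leq 1/3$ and point sets $P,Q$ in $\mathbb{R}^d$ with $|P|=|Q|=k$, $Q$ is an $\varepsilon$-approximate homothetic copy of $P$ if there exist a set $Q'=\{q'_1,\ldots,q'_k\}$ homothetic to $P$ and a labeling $Q=\{q_1,\ldots,q_k\}$ by distinct points such that, for each $i$, $q_i$ lies in the closed ball of radius $\varepsilon m$ centered at $q'_i$, where $m$ is the minimum pairwise distance among points of $Q'$. An $\varepsilon$-approximate arithmetic progression of $k$ terms is an $\varepsilon$-approximate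 homothetic copy of $\{1,2,\ldots,k\}\subset\mathbb{R}$.
   Formalization: The explicit formula is proved for k ≥ 2 (r = k/(k−1) is undefined at k = 1, where only existence is proved), with exponent max(j,0) instead of j: for negative j it fails, e.g. k=3, ε=1/3, δ=1, c=9/2, L=2/81 and S a single point. *)

(* Defs.v *)
From HB Require Import structures.
From mathcomp Require Import all_boot all_order all_algebra.
From mathcomp Require Import all_classical all_reals all_analysis.

Set Implicit Arguments.
Unset Strict Implicit.
Unset Printing Implicit Defensive.

Import Order.TTheory GRing.Theory Num.Theory.

Local Open Scope classical_set_scope.
Local Open Scope ring_scope.

(* Points live in the line R, with distance `|x - y|; R is any realType. *)

Definition separated (R : realType) (delta : R) (S : set R) : Prop :=
  forall x y : R, S x -> S y -> x <> y -> delta <= `|x - y|.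

Definition homothetic (R : realType) (P Q' : set R) : Prop :=
  exists lambda v : R,
    0 < lambda /\ Q' = [set lambda * p + v | p in P].

(* For a finite set with at least two points the infimum is a minimum.  On a
   set with at most one point it is inf set0 = 0; this makes every singleton
   an approximate homothetic copy of every singleton, as it would be for any
   other nonnegative convention. *)
Definition min_dist (R : realType) (A : set R) : R :=
  inf [set d | exists x y : R, [/\ A x, A y, x <> y & d = `|x - y|]].

(* The bijections from 'I_k make Q' and Q, hence also P, k-point sets. *)
Definition approx_homothetic_copy (R : realType) (k : nat) (eps : R)
    (P Q : set R) : Prop :=
  exists (Q' : set R) (q' q : 'I_k -> R),
    [/\ homothetic P Q',
        set_bij [set: 'I_k] Q' q',
        set_bij [set: 'I_k] Q q &
        forall i : 'I_k, `|q i - q' i| <= eps * min_dist Q'].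

Definition approx_AP (R : realType) (k : nat) (eps : R) (Q : set R) : Prop :=
  approx_homothetic_copy k eps
    [set i%:R | i in [set i : nat | (1 <= i <= k)%N]] Q.

(* The booleans decide which endpoints belong to the interval. *)
Definition interval_of_length (R : realType) (I : set R) (L : R) : Prop :=
  exists (bl br : bool) (a b : R),
    [/\ a <= b, I = [set` Interval (BSide bl a) (BSide br b)] & L = b - a].

Definition at_least_points (R : realType) (S : set R) (x : R) : Prop :=
  exists2 n : nat, x <= n%:R & (`I_n #<= S)%card.

Definition AP_threshold (R : realType) (k : nat) (c delta eps Z : R) : Prop :=
  0 < Z /\
  forall (L : R) (I S : set R),
    interval_of_length I L -> Z <= L ->
    S `<=` I -> separated delta S -> at_least_points S (c * L) ->
    exists2 Q : set R, Q `<=` S & approx_AP k eps Q.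

Definition sZ (R : realType) (eps : R) : int := Num.ceil (1 / eps).

Definition rZ (R : realType) (k : nat) : R := k%:R / (k%:R - 1).

Definition jZ (R : realType) (k : nat) (c delta : R) : int :=
  Num.ceil (ln (2 / (c * delta)) / ln (rZ R k)).

(* The exponent is read as 0 when the ceiling is negative, which happens only
   for c * delta > 2.  A negative exponent would give a false bound: with
   k = 3, eps = 1/3, delta = 1 and c = 9/2 it is -2, so that 2 * 9 ^ (-2) < 1/c,
   and an interval of that length may contain a single point of S. *)
Definition Z0 (R : realType) (k : nat) (c delta eps : R) : R :=
  2 * delta * (k%:R * (sZ eps)%:~R) ^ Num.max (jZ k c delta) 0.

(* Main.v *)
(** Cut the interval into [k * s] cells of equal width and group together the
    cells whose indices agree modulo [s].  If some group has a point of [S] in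
    each of its [k] cells, these points form an approximate progression, since
    the common difference is [s >= 1 / eps] cell widths.  Otherwise every group
    has an empty cell, so at most [(k - 1) * s] cells are occupied and one of
    them has density at least [k / (k - 1)] times the original one.  Iterating
    [j] times gives an interval of length at least [2 * delta] with density at
    least [2 / delta], which a [delta]-separated set cannot have. *)
Require Import Defs.
From mathcomp Require Import all_boot all_order all_algebra.
From mathcomp Require Import all_classical all_reals all_analysis.
From mathcomp Require Import ring lra.

Set Implicit Arguments.
Unset Strict Implicit.
Unset Printing Implicit Defensive.

Import Order.TTheory GRing.Theory Num.Theory.

Local Open Scope classical_set_scope.
Local Open Scope ring_scope.

(** * Packing bound for separated sets *)

(** Half-open windows of length [delta], laid from [a] on, hold at most one point each. So numbering
    the windows by [g] injects [X] into the indices up to [g b]. *)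
Lemma separated_size (R : realType) (S : set R) (delta a b : R) (X : seq R) :
  0 < delta -> a <= b -> Defs.separated delta S -> uniq X ->
  (forall x, x \in X -> S x /\ a <= x <= b) ->
  (size X)%:R <= (b - a) / delta + 1.
Proof.
move=> d0 ab sepS uX XS.
pose g (x : R) := Num.truncn ((x - a) / delta).
have gP x : x \in X -> (g x)%:R * delta <= x - a < (g x).+1%:R * delta.
  move=> /XS[_ /andP[ax _]].
  rewrite -ler_pdivlMr// -ltr_pdivrMr// truncn_itv//.
  by rewrite divr_ge0 ?subr_ge0// ltW.
have guniq : uniq (map g X).
  rewrite map_inj_in_uniq// => x y xX yX gxy.
  apply/eqP/negPn/negP => /eqP xy.
  have [Sx _] := XS _ xX; have [Sy _] := XS _ yX.
  have := sepS _ _ Sx Sy xy; rewrite leNgt => /negP; apply.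
  have := gP _ xX; have := gP _ yX; rewrite gxy -natr1 mulrDl mul1r.
  move=> /andP[? ?] /andP[? ?]; rewrite ltr_norml; lra.
have ba0 : 0 <= (b - a) / delta by rewrite divr_ge0 ?subr_ge0// ltW.
have gsub : {subset map g X <= iota 0 (g b).+1}.
  move=> _ /mapP[x xX ->]; rewrite mem_iota add0n ltnS /=.
  apply: le_truncn; rewrite ler_pM2r ?invr_gt0// lerB//.
  by have [_ /andP[]] := XS _ xX.
have := uniq_leq_size guniq gsub; rewrite size_map size_iota => sz.
apply: (@le_trans _ _ (g b).+1%:R); first by rewrite ler_nat.
by rewrite -natr1 lerD2r truncn_le.
Qed.

(** * Cells and the density increment *)

(** Cells are closed, so that each is again an interval of the kind that is subdivided. Neighbours
    share an endpoint. *)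
Definition cell (R : realType) (a w : R) (m : nat) (x : R) : bool :=
  a + m%:R * w <= x <= a + m.+1%:R * w.

Lemma cell_cover (R : realType) (a w x : R) (N : nat) :
  (0 < N)%N -> a <= x <= a + N%:R * w -> exists2 m, (m < N)%N & cell a w m x.
Proof.
elim: N => // -[_ _|N IHN _] /andP[ax xb].
  by exists 0%N; rewrite // /cell mul0r addr0 ax.
have [xN|Nx] := leP x (a + N.+1%:R * w).
  have [//||m mN xm] := IHN; first by rewrite ax.
  by exists m => //; exact: ltnW.
by exists N.+1; rewrite // /cell xb ltW.
Qed.

(** A cell index [m] is [t + i * s] with [t = m %% s] and [i = m %/ s]. Points on a common endpoint
    may be counted twice, hence only an inequality. *)
Lemma size_le_cells (R : realType) (a w : R) (k s : nat) (X : seq R) :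
  (0 < k)%N -> (0 < s)%N ->
  (forall x, x \in X -> a <= x <= a + (k * s)%:R * w) ->
  (size X <= \sum_(t < s) \sum_(i < k) count (cell a w (t + i * s)) X)%N.
Proof.
move=> k0 s0 XP.
elim: X XP => [//|x X IHX] XP /=.
under eq_bigr do rewrite big_split.
rewrite big_split /= -add1n leq_add//; last first.
  by apply: IHX => y yX; apply: XP; rewrite inE yX orbT.
have [|m mks xm] := @cell_cover R a w x _ _ (XP _ (mem_head _ _)).
  by rewrite muln_gt0 k0.
have ts : (m %% s < s)%N by rewrite ltn_mod.
have ik : (m %/ s < k)%N by rewrite ltn_divLR.
rewrite (bigD1 (Ordinal ts))//= (bigD1 (Ordinal ik))//=.
by rewrite (addnC (m %% s)%N) -divn_eq xm.
Qed.

(** If every cell held fewer than [c * rZ R k * w] points, each of the [s] groups, having at most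
    [k - 1] occupied cells, would hold fewer than [k * c * w]. The total would then fall below
    [c * (k * s) * w]. *)
Lemma denser_cell (R : realType) (a w c : R) (k s : nat) (X : seq R) :
  (1 < k)%N -> (0 < s)%N -> 0 < c -> 0 < w ->
  (forall x, x \in X -> a <= x <= a + (k * s)%:R * w) ->
  c * ((k * s)%:R * w) <= (size X)%:R ->
  (forall t : 'I_s, exists i : 'I_k, ~~ has (cell a w (t + i * s)) X) ->
  exists m, c * rZ R k * w <= (count (cell a w m) X)%:R.
Proof.
move=> k1 s0 c0 w0 XP cX empty.
apply: contrapT => /forallNP sparse.
have k0 : (0 < k)%N by exact: ltnW.
have k10 : 0 < k%:R - 1 :> R by rewrite subr_gt0 ltr1n.
have := size_le_cells k0 s0 XP; rewrite -(ler_nat R) => /(le_trans cX).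
apply/negP; rewrite -ltNge natr_sum.
have -> : c * ((k * s)%:R * w) = \sum_(t < s) (k%:R * c * w).
  by rewrite sumr_const card_ord -[RHS]mulr_natr natrM; ring.
apply: ltr_sum => [|t _].
  by apply/hasP; exists (Ordinal s0); rewrite ?mem_index_enum.
have [i0 /negbTE iP] := empty t.
rewrite (bigD1 i0)//= (_ : count _ _ = 0%N) ?add0n; last first.
  by apply/eqP; rewrite -leqn0 leqNgt -has_count iP.
(* The ratio is chosen so that [(k - 1) * rZ R k = k]. *)
have -> : k%:R * c * w = \sum_(i < k | i != i0) (c * rZ R k * w).
  rewrite sumr_const cardC1 card_ord -[RHS]mulr_natr -subn1 natrB// /rZ.
  by field; rewrite gt_eqF.
rewrite natr_sum; apply: ltr_sum => [|i _].
  have /card_gt0P[i ii0] : (0 < #|predC1 i0|)%N.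
    by rewrite cardC1 card_ord -subn1 subn_gt0.
  by apply/hasP; exists i; rewrite ?mem_index_enum.
by rewrite ltNge; apply/negP/sparse.
Qed.

(** * Near progressions in dense separated sets *)

(** Here the error is measured by the common difference [d] instead of [min_dist], and the terms are
    numbered from 0. *)
Definition near_progression (R : realType) (k : nat) (eps : R) (S : set R) :=
  exists (q : 'I_k -> R) (a d : R),
    [/\ injective q, forall i, S (q i), 0 < d &
        forall i, `|q i - (a + i%:R * d)| <= eps * d].

Lemma near_progression_cells (R : realType) (S : set R) (a w eps : R)
    (k s t : nat) :
  0 < w -> (1 < s)%N -> 1 <= eps * s%:R ->
  (forall i : 'I_k, exists2 x, S x & cell a w (t + i * s) x) ->
  near_progression k eps S.
Proof.
move=> w0 s1 es occ.
have /choice[q qP] : forall i : 'I_k, exists x, S x /\ cell a w (t + i * s) x.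
  by move=> i; have [x] := occ i; exists x.
have s1R : 2 <= s%:R :> R by rewrite ler_nat.
exists q, (a + t%:R * w), (s%:R * w); split.
- have lt_q (i j : 'I_k) : (i < j)%N -> q i < q j.
    move=> ij; have [_ /andP[_ qi]] := qP i; have [_ /andP[qj _]] := qP j.
    apply: (le_lt_trans qi); apply: lt_le_trans qj.
    (* As [s >= 2], a whole cell lies between two chosen ones, so closed cells still give distinct
       points. *)
    rewrite ltrD2l ltr_pM2r// ltr_nat -addnS ltn_add2l.
    apply: (@leq_trans (i.+1 * s)); last by rewrite leq_mul2r ij orbT.
    by rewrite mulSn -addn2 addnC leq_add2r.
  move=> i j qij; have [/lt_q|/lt_q|/val_inj//] := ltngtP (val i) (val j);
    by rewrite qij ltxx.
- by move=> i; have [] := qP i.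
- by rewrite mulr_gt0// ltr0n ltnW.
- move=> i; have [_ /andP[]] := qP i; rewrite -natr1 natrD natrM => h1 h2.
  (* Each point is within one cell width of the left end of its cell, and that width is at most
     [eps] times the common difference. *)
  have : w <= eps * (s%:R * w) by rewrite mulrA ler_peMl// ltW.
  move=> h3; rewrite ler_norml; lra.
Qed.

Lemma near_progression_dense (R : realType) (S : set R) (delta eps : R)
    (k s j : nat) (a b c : R) (X : seq R) :
  (1 < k)%N -> (1 < s)%N -> 1 <= eps * s%:R -> 0 < delta -> 0 < c ->
  Defs.separated delta S -> uniq X -> (forall x, x \in X -> S x /\ a <= x <= b) ->
  2 / delta <= c * rZ R k ^+ j -> 2 * delta * (k * s)%:R ^+ j <= b - a ->
  c * (b - a) <= (size X)%:R ->
  near_progression k eps S.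
Proof.
move=> k1 s1 es d0 + sepS.
have r0 : 0 < rZ R k by rewrite divr_gt0 ?subr_gt0 ?ltr1n// ltr0n ltnW.
have N0 : 0 < (k * s)%:R :> R by rewrite ltr0n muln_gt0 (ltnW k1) (ltnW s1).
(* The interval, the density and the list of points all change when passing to a cell, so they are
   generalized. *)
elim: j a b c X => [|j IHj] a b c X c0 uX XS cj Lj cX.
  exfalso; rewrite !expr0 !mulr1 in cj Lj.
  have ab : a <= b by lra.
  have /(le_trans cX) := separated_size d0 ab sepS uX XS.
  apply/negP; rewrite -ltNge.
  (* With [u = (b - a) / delta >= 2], density [2 / delta] asks for at least [2 * u] points, but the
     packing bound allows only [u + 1]. *)
  apply: (@lt_le_trans _ _ (2 / delta * (b - a))); last first.
    by rewrite ler_pM2r//; lra.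
  have : 2 <= (b - a) / delta by rewrite ler_pdivlMr.
  by rewrite mulrAC -mulrA; lra.
pose w := (b - a) / (k * s)%:R.
have Lw : 2 * delta * (k * s)%:R ^+ j <= w.
  by rewrite /w ler_pdivlMr// -(mulrA (2 * delta)) -exprSr.
have w0 : 0 < w by apply: lt_le_trans Lw; rewrite mulr_gt0 ?exprn_gt0// mulr_gt0.
have bE : b = a + (k * s)%:R * w.
  by rewrite /w mulrC divfK ?gt_eqF// addrC subrK.
have [/existsP[t /forallP occ]|] :=
    boolP [exists t : 'I_s, [forall i : 'I_k, has (cell a w (t + i * s)) X]].
  apply: (@near_progression_cells _ _ a w _ _ s t) => // i.
  by have /hasP[x /XS[Sx _] xi] := occ i; exists x.
rewrite negb_exists => /forallP empty.
have [||t|m cm] := @denser_cell R a w c k s X k1 (ltnW s1) c0 w0.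
- by move=> x /XS[_]; rewrite bE.
- by rewrite bE addrC addKr in cX.
- by apply/existsP; rewrite -negb_forall; exact: empty.
apply: (IHj (a + m%:R * w) (a + m.+1%:R * w) (c * rZ R k)
              [seq x <- X | cell a w m x]).
- by rewrite mulr_gt0.
- exact: filter_uniq.
- by move=> x; rewrite mem_filter => /andP[xm /XS[]].
- by rewrite -mulrA -exprS.
- by rewrite (_ : _ - _ = w)// -natr1; ring.
- by rewrite size_filter (_ : _ - _ = w)// -natr1; ring.
Qed.

(** * From near progressions to approximate arithmetic progressions *)

(** Keeping [min_dist] in the error bound lets this serve [k = 1] too, where [min_dist] is 0 rather
    than [d]. *)
Lemma approx_AP_range (R : realType) (k : nat) (eps v d : R) (q : 'I_k -> R) :
  0 < d -> injective q ->
  let q' (i : 'I_k) := d * i.+1%:R + v in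
  (forall i, `|q i - q' i| <= eps * min_dist (range q')) ->
  approx_AP k eps (range q).
Proof.
move=> d0 qinj q' qq'.
exists (range q'), q', q; split => //.
- exists d, v; split => //; apply/seteqP; split=> x /=.
    by move=> [i _ <-]; exists i.+1%:R => //; exists i.+1 => //=.
  move=> [_ [[//|i] /= ik <-] <-].
  by exists (Ordinal ik).
- split => [i _||//]; first by exists i.
  move=> i j _ _ /addIr /(mulfI (lt0r_neq0 d0)) /eqP.
  by rewrite eqr_nat eqSS => /eqP/val_inj.
- split => [i _|i j _ _ /qinj//|//].
  by exists i.
Qed.

(** Distinct terms differ by [d] times a nonzero integer. With [1 < k] the set of distances is
    nonempty, so its infimum is not the default 0. *)
Lemma min_dist_progression (R : realType) (k : nat) (v d : R) :
  (1 < k)%N -> 0 < d ->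
  d <= min_dist (range (fun i : 'I_k => d * i.+1%:R + v)).
Proof.
move=> k1 d0; apply: lb_le_inf.
  exists d, (d * 2 + v), (d * 1 + v); split.
  - by exists (Ordinal k1).
  - by exists (Ordinal (ltnW k1)).
  - by move=> /addIr /(mulfI (lt0r_neq0 d0)); lra.
  - by rewrite (_ : _ - _ = d) ?gtr0_norm//; ring.
move=> _ [_ [_ [[i _ <-] [j _ <-] ij ->]]].
rewrite (_ : _ - _ = d * (i%:Z - j%:Z)%:~R); last first.
  by rewrite intrB -!pmulrn -!natr1; ring.
rewrite normrM gtr0_norm// ler_peMr ?(ltW d0)// -intr_norm.
rewrite (ler_int R 1) -gtz0_ge1 normr_gt0 subr_eq0.
by apply/eqP => -[/val_inj eij]; rewrite eij in ij.
Qed.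

Lemma approx_AP_near_progression (R : realType) (k : nat) (eps : R) (S : set R) :
  (1 < k)%N -> 0 < eps -> near_progression k eps S ->
  exists2 Q : set R, Q `<=` S & approx_AP k eps Q.
Proof.
move=> k1 e0 [q [a [d [qinj qS d0 qP]]]].
exists (range q); first by move=> _ [i _ <-].
(* The shift by [d] accounts for the pattern starting at 1. *)
apply: (@approx_AP_range _ _ _ (a - d) d) => // i.
rewrite (_ : d * _ + _ = a + i%:R * d); last by rewrite -natr1; ring.
apply: (le_trans (qP i)); rewrite ler_pM2l//.
exact: min_dist_progression.
Qed.

Lemma approx_AP_singleton (R : realType) (eps x : R) :
  approx_AP 1 eps [set x].
Proof.
have -> : [set x] = range (fun _ : 'I_1 => x).
  by apply/seteqP; split => [_ ->|_ [_ _ <-]//]; exists ord0.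
(* The tolerance is 0 here, so the translation must send the pattern point 1 exactly to [x]. *)
apply: (@approx_AP_range _ _ _ (x - 1) 1) => // [i j _|i].
  by rewrite !ord1.
rewrite (_ : min_dist _ = 0).
  by rewrite mulr0 ord1 mul1r addrCA subrr addr0 subrr normr0.
rewrite -[RHS](@inf0 R); congr inf; apply/seteqP; split=> // d.
by move=> [_ [_ [[i0 _ <-] [i1 _ <-] +]]]; rewrite !ord1.
Qed.

(** * The explicit threshold *)

Lemma at_least_points_seq (R : realType) (S : set R) (x : R) :
  at_least_points S x ->
  exists X : seq R, [/\ uniq X, forall y, y \in X -> S y & x <= (size X)%:R].
Proof.
move=> [n xn /card_leP[f]].
pose u (i : 'I_n) : `I_n := SigSub (mem_set (ltn_ord i : `I_n i)).
pose g (i : 'I_n) : R := \val (f (u i)).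
have ginj : injective g.
  move=> i j /val_inj fij; apply: val_inj.
  by have /(congr1 val) := 'inj_f (in_setT (u i)) (in_setT (u j)) fij.
exists (map g (enum 'I_n)); split.
- by rewrite map_inj_uniq ?enum_uniq.
- by move=> y /mapP[i _ ->]; exact: set_valP.
- by rewrite size_map size_enum_ord.
Qed.

Lemma interval_of_length_bounds (R : realType) (I : set R) (L : R) :
  interval_of_length I L ->
  exists a b, L = b - a /\ (forall x, I x -> a <= x <= b).
Proof.
move=> [bl [br [a [b [_ -> ->]]]]]; exists a, b; split => // x /=.
rewrite itv_boundlr => /andP[ax xb]; apply/andP; split.
  by move: ax; case: bl; rewrite bnd_simp// => /ltW.
by move: xb; case: br; rewrite bnd_simp// => /ltW.
Qed.

(** Taking logarithms, with [ln (rZ R k) > 0]. Allowing any [j] above the ceiling covers the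
    exponent 0 used when the ceiling is negative. *)
Lemma rZ_exp_jZ (R : realType) (k j : nat) (c delta : R) :
  (1 < k)%N -> 0 < c -> 0 < delta -> jZ k c delta <= j%:Z ->
  2 / delta <= c * rZ R k ^+ j.
Proof.
move=> k1 c0 d0; rewrite /jZ ceil_le_int -pmulrn => jP.
have k10 : 0 < k%:R - 1 :> R by rewrite subr_gt0 ltr1n.
have r1 : 1 < rZ R k by rewrite ltr_pdivlMr// mul1r; lra.
have r0 : 0 < rZ R k by lra.
have : 2 / (c * delta) <= rZ R k ^+ j.
  rewrite -ler_ln ?posrE ?(exprn_gt0 _ r0) ?divr_gt0 ?mulr_gt0//.
  by rewrite lnXn// -[leRHS]mulr_natl -ler_pdivrMr// ln_gt0.
by rewrite invfM mulrCA mulrC ler_pdivrMr// [_ * c]mulrC.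
Qed.

Lemma AP_threshold_Z0 (R : realType) (k : nat) (c delta eps : R) :
  (1 < k)%N -> 0 < c -> 0 < delta -> 0 < eps -> eps <= 1 / 3 ->
  AP_threshold k c delta eps (Z0 k c delta eps).
Proof.
move=> k1 c0 d0 e0 e3.
have [s sE] : exists s : nat, sZ eps = s%:Z.
  exists `|sZ eps|%N; rewrite gez0_abs// ceil_ge0.
  by apply: (@lt_trans _ _ 0); rewrite ?ltrN10// divr_gt0.
have es : 1 <= eps * s%:R.
  by rewrite mulrC -ler_pdivrMr// pmulrn -sE; exact: ceil_ge.
(* Were [s <= 1], then [1 <= eps * s <= eps <= 1 / 3]. *)
have s1 : (1 < s)%N.
  rewrite -(ltr_nat R) ltNge; apply/negP => s_le1.
  have : eps * s%:R <= eps * 1 by rewrite ler_pM2l.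
  lra.
have [j jE] : exists j : nat, Num.max (jZ k c delta) 0 = j%:Z.
  by exists `|Num.max (jZ k c delta) 0|%N; rewrite gez0_abs// le_max lexx orbT.
have jP : jZ k c delta <= j%:Z by rewrite -jE le_max lexx.
have Z0E : Z0 k c delta eps = 2 * delta * (k * s)%:R ^+ j.
  by rewrite /Z0 sE jE -pmulrn -natrM.
split=> [|L I S /interval_of_length_bounds[a [b [-> Iab]]] ZL SI sepS].
  rewrite Z0E mulr_gt0 ?mulr_gt0// exprn_gt0// ltr0n muln_gt0.
  by rewrite (ltnW k1) (ltnW s1).
move=> /at_least_points_seq[X [uX XS cX]].
apply: approx_AP_near_progression => //.
apply: (@near_progression_dense _ S delta eps k s j a b c X) => //.
- by move=> x /XS Sx; split; [|exact/Iab/SI].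
- exact: rZ_exp_jZ.
- by rewrite -Z0E.
Qed.

Theorem theorem6 (R : realType) (k : nat) (c delta eps : R) :
  (0 < k)%N -> 0 < c -> 0 < delta -> 0 < eps -> eps <= 1 / 3 ->
  (exists Z : R, AP_threshold k c delta eps Z) /\
  ((1 < k)%N -> AP_threshold k c delta eps (Z0 k c delta eps)).
Proof.
move=> k0 c0 d0 e0 e3; split; last by move=> k1; exact: AP_threshold_Z0.
move: k0; rewrite leq_eqVlt => /predU1P[<-|k1]; last first.
  by exists (Z0 k c delta eps); exact: AP_threshold_Z0.
(* For [k = 1] the ratio [k / (k - 1)] has denominator 0. Any positive threshold works: [c * L > 0]
   forces a point of [S], and one point is a progression. *)
exists 1; split=> // L I S _ L1 _ _ /at_least_points_seq[[|x X] [_ XS cX]].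
  by move: cX; rewrite leNgt mulr_gt0//; lra.
exists [set x]; last exact: approx_AP_singleton.
by move=> _ ->; apply: XS; rewrite mem_head.
Qed.
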